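(* Let $a:\mathbb R\to\mathbb R$ be smooth with $a(\cdot)$, $a'(\cdot)$ uniformly bounded, with a single zero, satisfying $a(0)=0$ and $a(x)\gtrless0$ for $x\gtrless0$, and with $a$ uniformly bounded away from zero outside $[-\delta,\delta]$, for some $\delta>0$. Then, for the model problem $$w'-G(x)w=f,\qquad G(x)=\begin{pmatrix}0&i/\varepsilon\\ \tilde\gamma+ia(x)/\varepsilon&0\end{pmatrix},$$ there exists a smooth family of symmetrizers $S(\tilde\gamma,x,\varepsilon)$ on the whole line $x\in\mathbb R$, for $\tilde\gamma>0$ bounded and $\varepsilon>0$ sufficiently small, satisfying for some uniform $\theta>0$ $$\Re(SG+S_x)\ge\theta\tilde\gamma>0 .$$
   Context: $\Re M=\tfrac12(M+M^* )$, and $\Re M\ge c$ means $\Re M\ge c\,\mathrm{Id}$ as Hermitian matrices. A symmetrizer is a family of $2\times2$ matrices $S$ with $S=S^*$ and $|S|\le C_0$ ($C_0$ uniform in $x$ and in the parameters), satisfying the displayed lower bound; as to regularity in $x$, continuous and piecewise $C^1$ is admitted in the definition of symmetrizer. *)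

(* Defs.v *)
From HB Require Import structures.
From mathcomp Require Import all_boot all_order all_algebra.
From mathcomp Require Import all_classical all_reals all_analysis.
From mathcomp Require Import spectral complex.

Set Implicit Arguments.
Unset Strict Implicit.
Unset Printing Implicit Defensive.

Import Order.TTheory GRing.Theory Num.Theory.
Import numFieldNormedType.Exports.

Local Open Scope classical_set_scope.
Local Open Scope ring_scope.
Local Open Scope complex_scope.
Local Open Scope sesquilinear_scope.

(* C^infinity on the open set U: all iterated directional derivatives, in
   arbitrary directions and of arbitrary order, are Frechet differentiable at
   every point of U. *)
Definition smooth_on (R : realType) (V : normedModType R) (U : set V)
    (f : V -> R) : Prop :=
  forall (vs : seq V) (p : V), U p ->
    differentiable (foldr (fun v g => 'D_v g) f vs) p.

Definition smooth_mx_on (R : realType) (V : normedModType R) (U : set V)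
    (n : nat) (S : V -> 'M[R[i]]_n) : Prop :=
  forall i j : 'I_n,
    smooth_on U (fun p => complex.Re (S p i j)) /\
    smooth_on U (fun p => complex.Im (S p i j)).

Definition deriv_mx (R : realType) (n : nat) (S : R -> 'M[R[i]]_n) (x : R) :
    'M[R[i]]_n :=
  \matrix_(i, j) (derive1 (fun y => complex.Re (S y i j)) x +i*
                  derive1 (fun y => complex.Im (S y i j)) x).

Definition Re_mx (R : realType) (n : nat) (M : 'M[R[i]]_n) : 'M[R[i]]_n :=
  2^-1 *: (M + M ^t*).

(* M >= c Id as Hermitian matrices. The order of R[i] is partial: 0 <= z
   means that z is real and nonnegative. *)
Definition mx_ge (R : realType) (n : nat) (M : 'M[R[i]]_n) (c : R) : Prop :=
  forall v : 'cV[R[i]]_n, 0 <= (v ^t* *m (M - (c%:C)%:M) *m v) 0 0.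

Definition model_G (R : realType) (a : R -> R) (gamma x eps : R) :
    'M[R[i]]_2 :=
  \matrix_(i < 2, j < 2)
    nth 0 (nth [::] [:: [:: 0;                     0 +i* eps^-1];
                        [:: gamma +i* (a x / eps); 0           ]] i) j.

Definition params (R : realType) (gamma0 eps0 : R) : set (R * R * R) :=
  [set p | 0 < p.1.1 < gamma0 /\ 0 < p.2 < eps0].

(* S depends on p = (gamma, x, eps); `|_| is the maximum norm of the entries. *)
Definition symmetrizer (R : realType) (G : R -> R -> R -> 'M[R[i]]_2)
    (gamma0 eps0 C0 theta : R) (S : R * R * R -> 'M[R[i]]_2) : Prop :=
  forall gamma x eps : R, params gamma0 eps0 (gamma, x, eps) ->
    [/\ (S (gamma, x, eps)) ^t* = S (gamma, x, eps),
        `|S (gamma, x, eps)| <= C0%:C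
      & mx_ge (Re_mx (S (gamma, x, eps) *m G gamma x eps
                      + deriv_mx (fun y => S (gamma, y, eps)) x))
              (theta * gamma)].

(* Main.v *)
Require Import Defs.
From HB Require Import structures.
From mathcomp Require Import all_boot all_order all_algebra.
From mathcomp Require Import all_classical all_reals all_analysis.
From mathcomp Require Import spectral complex.
From mathcomp Require Import ring lra.

Set Implicit Arguments.
Unset Strict Implicit.
Unset Printing Implicit Defensive.

Import Order.TTheory GRing.Theory Num.Theory.
Import numFieldNormedType.Exports.

Local Open Scope classical_set_scope.
Local Open Scope ring_scope.

(** The key point is that the multiplier can be taken independent of [x]. In
    terms of the first component, [w' = G w] is the scalar equation
    [- eps^2 w1'' - a w1 + i eps gamma w1 = 0], a selfadjoint operator shifted
    by an imaginary constant of size [eps gamma]. Testing it against [w1] and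
    taking the imaginary part controls [gamma |w1|^2], because the real
    potential [a] drops out; this corresponds to a symmetrizer with real
    off-diagonal entries [K]. The real part controls [|w2|^2 = |eps w1'|^2]
    up to a term [a |w1|^2], which the first estimate absorbs for [K] large;
    added with the small weight [gamma], it corresponds to the off-diagonal
    entries [i eps gamma] and [- i eps gamma]. Altogether
    [[
       S = [[0, K + i eps gamma], [K - i eps gamma, 0]],
       Re (S G) = diag (gamma (K - a), gamma),
    ]]
    which is at least [gamma] as soon as [K >= 1 + sup a]. The matrix [S] has
    zero diagonal, so the off-diagonal entries of [Re (S G)] vanish, and it is
    constant in [x], so [S_x = 0]. Its entries are polynomial in the
    parameters, hence smooth. *)

(** Each directional derivative of such a quadratic polynomial in two linear
    forms is again one, which gives derivatives of all orders at once. *)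
Lemma smooth_quadratic (R : realType) (V : normedModType R) (U : set V)
    (l1 l2 : {linear V -> R}) (k0 k1 k2 k3 : R) :
  continuous l1 -> continuous l2 ->
  smooth_on U (fun p => k0 + k1 * l1 p + k2 * l2 p + k3 * (l1 p * l2 p)).
Proof.
move=> l1c l2c vs p _.
set quad := fun (k0 k1 k2 k3 : R) (p : V) =>
  k0 + k1 * l1 p + k2 * l2 p + k3 * (l1 p * l2 p).
have d1 q : is_diff q l1 l1.
  by apply: DiffDef; [exact: linear_differentiable | exact: diff_lin].
have d2 q : is_diff q l2 l2.
  by apply: DiffDef; [exact: linear_differentiable | exact: diff_lin].
have dquad h0 h1 h2 h3 q : is_diff q (quad h0 h1 h2 h3)
    (fun v => h1 * l1 v + h2 * l2 v + h3 * (l1 q * l2 v + l2 q * l1 v)).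
  have -> : quad h0 h1 h2 h3 =
      cst h0 + h1 *: (l1 : V -> R) + h2 *: (l2 : V -> R)
      + h3 *: ((l1 : V -> R) * (l2 : V -> R)) by apply/funext.
  apply: is_diff_eq; apply/funext => v.
  by rewrite add0r !fctE.
have [h0 [h1 [h2 [h3 ->]]]] : exists h0 h1 h2 h3,
    foldr (fun v g => 'D_v g) (quad k0 k1 k2 k3) vs = quad h0 h1 h2 h3.
  elim: vs => [|v vs [h0 [h1 [h2 [h3 /= ->]]]]]; first by exists k0, k1, k2, k3.
  (* Coefficients of the derivative in the direction [v]. *)
  exists (h1 * l1 v + h2 * l2 v), (h3 * l2 v), (h3 * l1 v), 0.
  apply/funext => q; rewrite deriveE; last exact: ex_diff.
  by rewrite diff_val /quad; ring.
exact: ex_diff.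
Qed.

Section Hermitian.
Local Open Scope complex_scope.
Local Open Scope sesquilinear_scope.

Lemma mx_ge_diag (R : realType) (n : nat) (M : 'M[R[i]]_n) (d : 'I_n -> R)
    (c : R) :
  M = diag_mx (\row_j (d j)%:C) -> (forall j, c <= d j) -> mx_ge M c.
Proof.
move=> -> cd v.
have -> : diag_mx (\row_j (d j)%:C) - (c%:C)%:M =
    diag_mx (\row_j (d j - c)%:C) :> 'M[R[i]]_n.
  by apply/matrixP => i j; rewrite !mxE -mulrnBl rmorphB.
rewrite mxE; apply: sumr_ge0 => j _.
rewrite mul_mx_diag !mxE mulrAC mulr_ge0//; last by rewrite lecR subr_ge0.
by rewrite mulrC mul_conjC_ge0.
Qed.

Definition multiplier (R : realType) (K : R) (p : R * R * R) : 'M[R[i]]_2 :=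
  \matrix_(i < 2, j < 2)
    nth 0 (nth [::] [:: [:: 0; K +i* (p.2 * p.1.1)];
                        [:: K -i* (p.2 * p.1.1); 0]] i) j.

Lemma smooth_multiplier (R : realType) (K : R) (U : set (R * R * R)) :
  smooth_mx_on U (multiplier K).
Proof.
pose eps : {linear (R * R * R)%type -> R} := snd.
pose gamma : {linear (R * R * R)%type -> R} := (fst \o fst)%FUN.
have epsc : continuous eps by move=> p; exact: cvg_snd.
have gammac : continuous gamma.
  by move=> p; apply: (@continuous_comp _ _ _ fst fst); exact: cvg_fst.
have smooth f : (exists k0 k3, f = fun p => k0 + k3 * (p.2 * p.1.1)) ->
    smooth_on U f.
  move=> [k0 [k3 ->]].
  have := @smooth_quadratic _ _ U eps gamma k0 0 0 k3 epsc gammac.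
  by under [X in smooth_on _ X]eq_fun do rewrite !mul0r !addr0.
by move=> [[|[|//]] ?] [[|[|//]] ?]; split; apply: smooth;
  [ exists 0, 0 | exists 0, 0 | exists K, 0 | exists 0, 1
  | exists K, 0 | exists 0, (-1) | exists 0, 0 | exists 0, 0 ];
  apply/funext => p; rewrite mxE /= ?mul0r ?add0r ?addr0 ?mul1r ?mulN1r.
Qed.

Lemma deriv_mx_cst (R : realType) (n : nat) (A : 'M[R[i]]_n) (x : R) :
  deriv_mx (fun=> A) x = 0.
Proof. by apply/matrixP => i j; rewrite !mxE !derive1_cst. Qed.

Lemma multiplier_hermitian (R : realType) (K : R) (p : R * R * R) :
  (multiplier K p) ^t* = multiplier K p.
Proof.
apply/matrixP => i j; rewrite !mxE.
by case: i => [[|[|//]]] ?; case: j => [[|[|//]]] ? /=;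
  apply/eqP; rewrite eq_complex /= ?oppr0 ?opprK !eqxx.
Qed.

Lemma norm_multiplier (R : realType) (K gamma x eps : R) :
  0 <= K -> 0 <= eps -> 0 <= gamma ->
  `|multiplier K (gamma, x, eps)| <= (K + eps * gamma)%:C.
Proof.
move=> K0 eps0 gamma0; have eg0 : 0 <= eps * gamma by rewrite mulr_ge0.
have B0 : 0 <= (K + eps * gamma)%:C by rewrite lecR addr_ge0.
have normK (b : R) : `|b| = eps * gamma ->
    `|K +i* b| <= (K + eps * gamma)%:C.
  move=> bE; rewrite [_ +i* _]complexE; apply: le_trans (ler_normD _ _) _.
  rewrite normrM !normc_def /= expr0n expr1n /= add0r sqrtr1 mul1r.
  by rewrite !addr0 !sqrtr_sqr bE ger0_norm// rmorphD.
rewrite -[leLHS]/(mx_norm _).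
have [->//|/mx_norm_neq0[[i j] ->]] :=
  eqVneq (mx_norm (multiplier K (gamma, x, eps))) 0.
rewrite mxE.
by case: i => [[|[|//]]] ?; case: j => [[|[|//]]] ? /=;
  rewrite ?normr0// normK// ?normrN ger0_norm.
Qed.

(** The imaginary parts [eps gamma] and [- eps gamma] meet the entries of
    size [1 / eps] of [G], and the weight [eps] brings these products to the
    size [gamma] uniformly in [eps]. The products of [K] with the same entries
    may be large, but they are purely imaginary and disappear in the real
    part. *)
Lemma Re_multiplier_G (R : realType) (a : R -> R) (K gamma x eps : R) :
  0 < eps ->
  Re_mx (multiplier K (gamma, x, eps) *m model_G a gamma x eps) =
  diag_mx (\row_(j < 2) (if j == 0 then gamma * (K - a x) else gamma)%:C).
Proof.
move=> eps0; have epsN0 : eps != 0 by rewrite gt_eqF.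
have half : (2^-1 : R[i]) = (2^-1 : R)%:C by rewrite fmorphV rmorph_nat.
apply/matrixP => i j; rewrite !mxE !big_ord_recl !big_ord0 !mxE half.
by case: i => [[|[|//]]] ?; case: j => [[|[|//]]] ? /=;
  apply/eqP; rewrite eq_complex /=; apply/andP; split; apply/eqP;
  simpc => /=; field; rewrite ?epsN0.
Qed.
End Hermitian.

Theorem proposition5p5 (R : realType) (a : R -> R) (delta : R)
    (a_smooth : smooth_on setT a)
    (a_bounded : exists M : R, forall x : R, `|a x| <= M)
    (da_bounded : exists M : R, forall x : R, `|derive1 a x| <= M)
    (a_zero : forall x : R, a x = 0 <-> x = 0)
    (a_pos : forall x : R, 0 < x -> 0 < a x)
    (a_neg : forall x : R, x < 0 -> a x < 0)
    (delta_gt0 : 0 < delta)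
    (a_away : exists2 c : R, 0 < c & forall x : R, delta < `|x| -> c <= `|a x|)
    (gamma0 : R) (gamma0_gt0 : 0 < gamma0) :
  exists eps0 C0 theta : R, exists S : R * R * R -> 'M[complex R]_2,
    [/\ 0 < eps0, 0 < theta,
        smooth_mx_on (params gamma0 eps0) S
      & symmetrizer (model_G a) gamma0 eps0 C0 theta S].
Proof.
have [M aM] := a_bounded.
have M0 : 0 <= M by apply: le_trans (aM 0).
exists 1, (M + 1 + gamma0), 1, (multiplier (M + 1)).
split => //; first exact: smooth_multiplier.
move=> gamma x eps [/= /andP[gamma_gt0 gamma_lt] /andP[eps_gt0 eps_lt]].
split; first exact: multiplier_hermitian.
- apply: (le_trans (norm_multiplier _ _ _ _)); [lra|lra|lra|].
  by rewrite lecR lerD2l; nra.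
- rewrite (deriv_mx_cst (multiplier (M + 1) (gamma, x, eps))) addr0.
  apply: (mx_ge_diag (Re_multiplier_G _ _ _ _ eps_gt0)) => j.
  have aM' : a x <= M := le_trans (ler_norm _) (aM x).
  by case: ifP => _; nra.
Qed.
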